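(* Let $\mathbf{u}$ be a (right-sided infinite) sequence over a finite alphabet. Then $\mathbf{u}$ is eventually periodic if and only if there exists $n \in \mathbb{N}$ such that $r_{\mathbf{u}}(n+2) = r_{\mathbf{u}}(n)$.
   Context: $\mathbb{N}$ includes $0$. For a sequence $\mathbf{u}=u_0u_1u_2\cdots$ over a finite alphabet, $\mathcal{L}_n(\mathbf{u})=\{u_iu_{i+1}\cdots u_{i+n-1} : i\in\mathbb{N}\}$ is the set of factors of $\mathbf{u}$ of length $n$ (for $n=0$ it consists of the empty word only). The reversal of a word $w=w_0w_1\cdots w_{n-1}$ is $\overline{w}=w_{n-1}\cdots w_1w_0$. Two words $u,v$ are (reflectively) equivalent, $u\sim_r v$, if $u=v$ or $u=\overline{v}$. The reflection complexity of $\mathbf{u}$ is the map $r_{\mathbf{u}}:\mathbb{N}\to\mathbb{N}$ where $r_{\mathbf{u}}(n)$ is the number of distinct elements of $\mathcal{L}_n(\mathbf{u})$ up to the equivalence $\sim_r$. A sequence $\mathbf{u}$ is eventually periodic if $\mathbf{u}=wvvv\cdots$ for some finite words $w$ and $v$ with $v$ non-empty. *)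

(* Defs.v *)
From mathcomp Require Import all_boot.
From mathcomp Require Import boolp.

Set Implicit Arguments.
Unset Strict Implicit.
Unset Printing Implicit Defensive.

Section ReflectionComplexity.
Variable A : finType.

Definition factor_at (u : nat -> A) (n i : nat) : n.-tuple A :=
  [tuple u (i + j) | j < n].

(* Membership quantifies over all positions i : nat, hence the classical
   truth value `[< _ >]. *)
Definition factors (u : nat -> A) (n : nat) : {set n.-tuple A} :=
  [set w | `[< exists i : nat, w = factor_at u n i >]].

Definition refl_equiv (n : nat) : rel (n.-tuple A) :=
  fun v w => (v == w) || (v == [tuple of rev w]).

(* The number of classes of [refl_equiv] restricted to [factors u n]. The set
   of factors need not be closed under reversal: a class consists of the
   factors equivalent to a given factor. *)
Definition refl_complexity (u : nat -> A) (n : nat) : nat :=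
  #|equivalence_partition (@refl_equiv n) (factors u n)|.

(* The infinite word w v v v ...; [a] is a default letter for [nth], never used
   when v is non-empty. *)
Definition eventually_periodic_word (a : A) (w v : seq A) : nat -> A :=
  fun i => if i < size w then nth a w i
           else nth a v ((i - size w) %% size v).

Definition eventually_periodic (u : nat -> A) : Prop :=
  exists w v : seq A,
    v != [::] /\ forall i, u i = eventually_periodic_word (u 0) w v i.

Lemma refl_equivP (n : nat) : equivalence_rel (@refl_equiv n).
Proof.
have rK (x : n.-tuple A) : [tuple of rev [tuple of rev x]] = x.
  by apply: val_inj; rewrite /= revK.
have sym (x y : n.-tuple A) : refl_equiv x y -> refl_equiv y x.
  by case/orP=> /eqP ->; rewrite /refl_equiv ?rK eqxx ?orbT.
have tr (x y z : n.-tuple A) :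
    refl_equiv x y -> refl_equiv y z -> refl_equiv x z.
  by move=> /orP[] /eqP -> // /orP[] /eqP ->; rewrite /refl_equiv ?rK eqxx ?orbT.
move=> x y z; split=> [|xy]; first by rewrite /refl_equiv eqxx.
by apply/idP/idP; apply: tr => //; apply: sym.
Qed.

End ReflectionComplexity.

(* Main.v *)
Require Import Defs.
From mathcomp Require Import all_boot.
From mathcomp Require Import boolp zify.

(** Write [S u] for the shifted sequence [u 1, u 2, ...]. Deleting the first and
    the last letter commutes with reversal, so it acts on classes of words, and
    it maps the classes of length [n + 2] of [u] onto the classes of length [n]
    of [S u]. The classes of length [n] of [u] are those of [S u] together with
    the class of the prefix of length [n]. There are two cases.

    - The prefix class of length [n] occurs in [S u]. Then trimming maps the
      classes of length [n + 2] of [u] onto those of length [n] of [u], so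
      [r (n) <= r (n + 2)], and equality makes trimming injective. In that case
      every factor of length [n + 1] has only one right extension: if [a w b]
      and [a w d] are both factors, they have the same trimming [w], hence are
      equivalent, and either they are equal or [a w b] is the reversal of
      [a w d], which gives [b = a = d]. By the pigeonhole principle some factor
      of length [n + 1] occurs twice, and from then on [u] is periodic.

    - The prefix class of length [n] does not occur in [S u]. Then neither does
      that of length [n + 2], since a window equivalent to the longer prefix
      contains one equivalent to the shorter prefix. Hence passing from [u] to
      [S u] lowers both [r (n)] and [r (n + 2)] by exactly one, and induction on
      [r (n)] applies.

    So [r (n) <= r (n + 2)] always, and equality forces eventual periodicity
    ([refl_complexity_leq_add2]). Conversely an eventually periodic sequence has
    bounded reflection complexity, so [r (0) <= r (2) <= r (4) <= ...] cannot be
    strictly increasing. *)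

Set Implicit Arguments.
Unset Strict Implicit.
Unset Printing Implicit Defensive.

(** * Words up to reversal *)

Section Words.
Variable A : finType.

Definition shift (u : nat -> A) : nat -> A := fun i => u i.+1.

Definition revt n (w : n.-tuple A) : n.-tuple A := [tuple of rev w].

Definition refl_class n (w : n.-tuple A) : {set n.-tuple A} := [set w; revt w].

Definition window n (k : nat) (w : n.+2.-tuple A) : n.-tuple A :=
  [tuple tnth w (inord (k + i)) | i < n].

Definition classes (u : nat -> A) n : {set {set n.-tuple A}} :=
  @refl_class n @: factors u n.

Lemma revtK n : involutive (@revt n).
Proof. by move=> w; apply: val_inj; rewrite /= revK. Qed.

Lemma refl_classP n (v w : n.-tuple A) :
  reflect (refl_class v = refl_class w) (refl_equiv v w).
Proof.
apply: (iffP orP) => [[] /eqP -> // | eq_vw].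
  by rewrite -/(revt w) /refl_class revtK setUC.
have : v \in refl_class w by rewrite -eq_vw set21.
by rewrite in_set2 => /orP[] ->; [left | right].
Qed.

Lemma refl_class_eq n (v w : n.-tuple A) :
  refl_class v = refl_class w -> v = w \/ v = revt w.
Proof. by move/refl_classP/orP=> [] /eqP; [left | right]. Qed.

Lemma refl_class_revt n (w : n.-tuple A) : refl_class (revt w) = refl_class w.
Proof. by rewrite /refl_class revtK setUC. Qed.

Lemma tnth_revt n (w : n.-tuple A) (i : 'I_n) :
  tnth (revt w) i = tnth w (rev_ord i).
Proof.
have x0 := tnth w i.
by rewrite !(tnth_nth x0) /= nth_rev ?size_tuple // ltn_ord.
Qed.

Lemma window_revt n k (w : n.+2.-tuple A) : k <= 2 ->
  window k (revt w) = revt (window (2 - k) w).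
Proof.
move=> k2; apply: eq_from_tnth => i.
rewrite tnth_revt !tnth_mktuple tnth_revt; congr (tnth w _).
apply: val_inj; case: i => i lt_in.
by rewrite /= !inordK /=; lia.
Qed.

Lemma tnth_factor (u : nat -> A) n i (j : 'I_n) :
  tnth (factor_at u n i) j = u (i + j).
Proof. by rewrite tnth_mktuple. Qed.

Lemma window_factor (u : nat -> A) n k i : k <= 2 ->
  window k (factor_at u n.+2 i) = factor_at u n (i + k).
Proof.
move=> k2; apply: eq_from_tnth => j.
rewrite tnth_mktuple !tnth_factor inordK ?addnA //.
by have := ltn_ord j; lia.
Qed.

Lemma factor_shift (u : nat -> A) n i :
  factor_at (shift u) n i = factor_at u n i.+1.
Proof. by apply: eq_from_tnth => j; rewrite !tnth_factor. Qed.

Lemma classesP (u : nat -> A) n c :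
  reflect (exists i, c = refl_class (factor_at u n i)) (c \in classes u n).
Proof.
apply: (iffP imsetP) => [[w] | [i ->]].
  by rewrite inE => /asboolP[i ->] ->; exists i.
by exists (factor_at u n i); rewrite // inE; apply/asboolP; exists i.
Qed.

Lemma mem_classes (u : nat -> A) n i :
  refl_class (factor_at u n i) \in classes u n.
Proof. by apply/classesP; exists i. Qed.

(** The blocks of the partition depend on the set of factors, which need not be
    closed under reversal, whereas [refl_class w] always contains both [w] and
    its reversal. Either set determines the other, by intersecting with the
    factors or by taking the union of the classes of its elements. *)
Lemma refl_complexityE (u : nat -> A) n :
  refl_complexity u n = #|classes u n|.
Proof.
set D := factors u n.
have -> : refl_complexity u n = #|(fun c => c :&: D) @: classes u n|.
  rewrite /classes -imset_comp; congr #|pred_of_set _|.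
  apply: eq_in_imset => w _; apply/setP=> v; rewrite !inE andbC.
  congr andb; apply/idP/idP.
    by move/refl_classP=> eq_wv; rewrite -in_set2 -/(refl_class w) eq_wv set21.
  by case/orP=> /eqP ->; apply/refl_classP; rewrite ?refl_class_revt.
apply: card_in_imset => c d /imsetP[v Dv ->] /imsetP[w Dw ->] eq_vw.
have: v \in refl_class w :&: D by rewrite -eq_vw inE set21.
by rewrite !inE => /andP[/orP[] /eqP -> _]; rewrite ?refl_class_revt.
Qed.

End Words.

Arguments classes {A} u n.

(** * Periodicity *)

Section Periodicity.
Variables (A : finType) (u : nat -> A).

Lemma eventually_periodicP :
  eventually_periodic u <->
  exists N p, 0 < p /\ forall i, N <= i -> u (i + p) = u i.
Proof.
split=> [[w [v [v0 uE]]] | [N [p [p0 uE]]]].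
  exists (size w), (size v); split=> [|i le_wi]; first by rewrite lt0n size_eq0.
  rewrite (uE i) (uE (i + _)) /eventually_periodic_word !ltnNge le_wi.
  by rewrite (leq_trans le_wi (leq_addr _ _)) /= addnC -addnBA // modnDl.
have step m k : u (N + k + m * p) = u (N + k).
  elim: m => [|m IHm]; first by rewrite addn0.
  by rewrite mulSn [p + _]addnC addnA uE // -addnA leq_addr.
exists (mkseq u N), (mkseq (fun k => u (N + k)) p).
split=> [|i]; first by rewrite -size_eq0 size_mkseq -lt0n.
rewrite /eventually_periodic_word !size_mkseq.
case: ltnP => [lt_iN | le_Ni]; first by rewrite nth_mkseq.
rewrite nth_mkseq ?ltn_pmod // -(step ((i - N) %/ p)) -addnA [_ %% _ + _]addnC.
by rewrite -divn_eq subnKC.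
Qed.

(** If a factor of length [m] always has the same right extension, then a
    repeated factor forces the two tails that follow it to agree, and some factor
    of length [m] is repeated because there are finitely many of them. *)
Lemma eventually_periodic_deterministic m :
    (forall i j, factor_at u m i = factor_at u m j -> u (i + m) = u (j + m)) ->
  eventually_periodic u.
Proof.
move=> det; apply/eventually_periodicP.
pose f (k : 'I_#|{: m.-tuple A}|.+1) := factor_at u m k.
have [i [j lt_ij eq_ij]] :
    exists i, exists2 j, i < j & factor_at u m i = factor_at u m j.
  have /fintype.injectivePn[i [j neq_ij eq_ij]] : ~~ injectiveb f.
    by apply/injectiveP => /leq_card; rewrite card_ord ltnn.
  have [lt_ij|lt_ji|/val_inj eq'] := ltngtP i j.
  - by exists i; exists j.
  - by exists j; exists i.
  - by rewrite eq' eqxx in neq_ij.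
(* The factor at [i + k.+1] is the one at [i + k] without its first letter,
   followed by the letter that [det] determines. *)
have tail k : factor_at u m (i + k) = factor_at u m (j + k).
  elim: k => [|k IHk]; first by rewrite !addn0.
  apply: eq_from_tnth => l; rewrite !tnth_factor.
  have [lt_lm | le_ml] := ltnP l.+1 m.
    have := congr1 (fun w => tnth w (Ordinal lt_lm)) IHk.
    by rewrite !tnth_factor /= !addnS !addSn.
  have -> : nat_of_ord l = m.-1 by have := ltn_ord l; lia.
  have mE : m = m.-1.+1 by have := ltn_ord l; lia.
  have := det _ _ IHk; rewrite [in i + k + m]mE [in j + k + m]mE.
  by rewrite /= !addnS !addSn.
exists (i + m), (j - i); split=> [|k le_k]; first by rewrite subn_gt0.
have := det _ _ (tail (k - i - m)).
have -> : i + (k - i - m) + m = k by lia.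
by have -> : j + (k - i - m) + m = k + (j - i) by lia.
Qed.

End Periodicity.

Lemma eventually_periodic_shift (A : finType) (u : nat -> A) :
  eventually_periodic (shift u) -> eventually_periodic u.
Proof.
move/eventually_periodicP=> [N [p [p0 uE]]]; apply/eventually_periodicP.
by exists N.+1, p; split=> // -[//|i] le_Ni; apply: uE.
Qed.

(** * Trimming and the comparison of r(n) with r(n + 2) *)

Section Trimming.
Variable A : finType.

Definition trim n (c : {set n.+2.-tuple A}) : {set n.-tuple A} :=
  [set window 1 w | w in c].

Lemma trim_refl_class n (w : n.+2.-tuple A) :
  trim (refl_class w) = refl_class (window 1 w).
Proof. by rewrite /trim /refl_class imsetU1 imset_set1 window_revt. Qed.

Lemma trim_factor (u : nat -> A) n i :
  trim (refl_class (factor_at u n.+2 i)) = refl_class (factor_at u n i.+1).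
Proof. by rewrite trim_refl_class window_factor // addn1. Qed.

(** The prefix of [u] has no left extension, so it need not be a trimming: this
    is why the image consists of the classes of the shifted sequence. *)
Lemma trim_classes (u : nat -> A) n :
  [set trim c | c in classes u n.+2] = classes (shift u) n.
Proof.
apply/setP=> d; apply/imsetP/classesP=> [[c /classesP[i ->] ->] | [i ->]].
  by exists i; rewrite trim_factor factor_shift.
exists (refl_class (factor_at u n.+2 i)); first exact: mem_classes.
by rewrite trim_factor factor_shift.
Qed.

Lemma classes_shift (u : nat -> A) n :
  classes u n = refl_class (factor_at u n 0) |: classes (shift u) n.
Proof.
apply/setP=> c; rewrite in_setU1.
apply/classesP/predU1P=> [[[|i] ->] | [-> | /classesP[i ->]]].
- by left.
- by right; rewrite -factor_shift mem_classes.
- by exists 0.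
- by exists i.+1; rewrite factor_shift.
Qed.

(** A window of length [n + 2] equivalent to the prefix starts, up to reversal,
    with a window equivalent to the shorter prefix: this one begins at the same
    position, or two letters later when the longer window is reversed. *)
Lemma prefix_class_recurs (u : nat -> A) n :
    refl_class (factor_at u n.+2 0) \in classes (shift u) n.+2 ->
  refl_class (factor_at u n 0) \in classes (shift u) n.
Proof.
case/classesP=> i /refl_class_eq eq_w.
rewrite -[in factor_at u n 0](addn0 0) -window_factor //.
case: eq_w => ->; rewrite ?window_revt // window_factor ?refl_class_revt //;
  exact: mem_classes.
Qed.

(** The injectivity hypothesis makes right extensions of factors of length
    [n + 1] unique: two extensions [a w b] and [a w d] trim to the same [w], so
    they are equal or mutual reversals, and in both cases [b = d]. *)
Lemma eventually_periodic_trim_inj (u : nat -> A) n :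
  {in classes u n.+2 &, injective (@trim n)} -> eventually_periodic u.
Proof.
move=> trim_inj.
apply: (@eventually_periodic_deterministic _ _ n.+1) => i j eq_ij.
have eqk k : k <= n -> u (i + k) = u (j + k).
  rewrite -ltnS => lt_k; have := congr1 (fun w => tnth w (Ordinal lt_k)) eq_ij.
  by rewrite !tnth_factor.
have /trim_inj : trim (refl_class (factor_at u n.+2 i))
               = trim (refl_class (factor_at u n.+2 j)).
  rewrite !trim_factor; congr refl_class; apply: eq_from_tnth => k.
  by rewrite !tnth_factor !addSnnS eqk.
move=> /(_ (mem_classes _ _ _) (mem_classes _ _ _)) /refl_class_eq[] eq_w.
  by have := congr1 (fun w => tnth w ord_max) eq_w; rewrite !tnth_factor.
have := congr1 (fun w => tnth w ord_max) eq_w.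
have := congr1 (fun w => tnth w ord0) eq_w.
rewrite !tnth_revt !tnth_factor /= subn1 subnn /= eqk // => <- ->.
by [].
Qed.

(** The inequality and its equality case share one induction on [r (n)]. If the
    prefix class recurs, all classes of length [n] are trimmings; otherwise the
    shift removes one class at each of the two lengths, which leaves both the
    inequality and the equality unchanged. *)
Lemma refl_complexity_leq_add2 (u : nat -> A) n :
  refl_complexity u n <= refl_complexity u n.+2
    /\ (refl_complexity u n.+2 = refl_complexity u n -> eventually_periodic u).
Proof.
rewrite !refl_complexityE.
have [m] := ubnP #|classes u n|; elim: m u => // m IHm u.
have recE k := cardsU1 (refl_class (factor_at u k 0)) (classes (shift u) k).
have [recurs | unique] :=
  boolP (refl_class (factor_at u n 0) \in classes (shift u) n).
  have eq_trim : classes u n = [set trim c | c in classes u n.+2].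
    by rewrite trim_classes classes_shift; apply/setUidPr; rewrite sub1set.
  rewrite eq_trim => _; split=> [|eq_card]; first exact: leq_imset_card.
  by apply: (@eventually_periodic_trim_inj u n); apply/imset_injP/eqP/esym.
have unique2 := contra (@prefix_class_recurs u n) unique.
rewrite (classes_shift u n) (classes_shift u n.+2) !recE unique unique2.
rewrite !add1n !ltnS => /IHm[le_add2 periodic_eq]; split=> // -[eq_card].
exact/eventually_periodic_shift/periodic_eq.
Qed.

End Trimming.

(** * Eventually periodic sequences *)

(** Beyond the preperiod [N] a factor occurs again [p] letters earlier, so the
    factors starting at the first [N + p] positions are all of them. *)
Lemma refl_complexity_bounded (A : finType) (u : nat -> A) :
  eventually_periodic u -> exists B, forall n, refl_complexity u n <= B.
Proof.
case/eventually_periodicP=> N [p [p0 uE]]; exists (N + p) => n.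
rewrite refl_complexityE; apply: leq_trans (leq_imset_card _ _) _.
have sub : factors u n \subset [set factor_at u n i | i : 'I_(N + p)].
  apply/subsetP=> w; rewrite inE => /asboolP[i ->] {w}.
  elim/ltn_ind: i => i IHi; have [lt_i | le_i] := ltnP i (N + p).
    by apply/imsetP; exists (Ordinal lt_i).
  have -> : factor_at u n i = factor_at u n (i - p).
    apply: eq_from_tnth => k; rewrite !tnth_factor -(uE (i - p + k)); last lia.
    by congr u; lia.
  by apply: IHi; lia.
apply: leq_trans (subset_leq_card sub) _.
by apply: leq_trans (leq_imset_card _ _) _; rewrite card_ord.
Qed.

Theorem theorem10 (A : finType) (u : nat -> A) :
  eventually_periodic u <->
  exists n : nat, refl_complexity u (n + 2) = refl_complexity u n.
Proof.
split=> [/refl_complexity_bounded[B leB] | [n]]; last first.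
  by rewrite addn2; apply: (refl_complexity_leq_add2 u n).2.
apply: contrapT => no_eq.
have grow m : m <= refl_complexity u m.*2.
  elim: m => // m IHm; apply: leq_ltn_trans IHm _.
  rewrite doubleS ltn_neqAle (refl_complexity_leq_add2 u _).1 andbT.
  by apply/eqP=> eq_r; apply: no_eq; exists m.*2; rewrite addn2.
by have := leq_trans (grow B.+1) (leB _); rewrite ltnn.
Qed.
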